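(* Let $X$ be a complete $\mathrm{CAT}(0)$ space and let $\Gamma$ be a group of isometries of $X$ whose orbits are all bounded. Let $f:X\to\mathbb{R}$ be a positive valued, bounded and uniformly continuous function. Let $\Gamma/X$ be the quotient space of orbits. For each orbit $O(x)\in\Gamma/X$ define $F(O(x))=O(y)$, where $y$ is the barycenter in $X$ of the set $O(x)\subseteq X$ relative to $f$. Then $F:\Gamma/X\to\Gamma/X$ is continuous.
   Context: $O(x)$ denotes the $\Gamma$-orbit of $x$, and $\Gamma/X$ carries the quotient topology. For $P\subseteq X$ non-empty and bounded and $u$ a bounded positive function on $P$, the barycenter of $P$ relative to $u$ is the point $q_u\in X$ (which exists and is unique) such that $\sup\{u(p)d(q_u,p)\mid p\in P\}=\inf_{x\in X}\sup\{u(p)d(x,p)\mid p\in P\}$; here it is applied with $P=O(x)$ and $u=f|_{O(x)}$. *)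

(* Defs.v *)
From HB Require Import structures.
From mathcomp Require Import all_boot all_order all_algebra.
From mathcomp Require Import all_classical all_reals all_analysis.

Set Implicit Arguments.
Unset Strict Implicit.
Unset Printing Implicit Defensive.

Import Order.TTheory GRing.Theory Num.Theory.
Import numFieldNormedType.Exports.

Local Open Scope classical_set_scope.
Local Open Scope ring_scope.
Local Open Scope quotient_scope.

Section euclidean_plane.
Variable R : realType.

(* The library norm on 'rV[R]_2 is the sup norm, hence this explicit
   Euclidean distance. *)
Definition plane_dist (a b : 'rV[R]_2) : R :=
  Num.sqrt (\sum_(k < 2) (a 0 k - b 0 k) ^+ 2).

Definition plane_segment (a b : 'rV[R]_2) : set 'rV[R]_2 :=
  [set (1 - t) *: a + t *: b | t in `[0, 1]].

End euclidean_plane.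

Section metric_notions.
Variables (R : realType) (X : metricType R).
Implicit Types (x y p q : X) (A P S : set X).

(* The property defining completeType, without its base point, so that no
   point of X has to be chosen. *)
Definition complete_space : Prop :=
  forall F : set_system X, ProperFilter F -> cauchy F -> exists x, F --> x.

Definition metric_bounded A : Prop :=
  exists M : R, forall x y, A x -> A y -> mdist x y <= M.

Definition geodesic x y (c : R -> X) : Prop :=
  [/\ c 0 = x, c (mdist x y) = y &
    forall s t, s \in `[0, mdist x y] -> t \in `[0, mdist x y] ->
      mdist (c s) (c t) = `|s - t|].

Definition geodesic_segment x y S : Prop :=
  exists2 c, geodesic x y c & S = c @` `[0, mdist x y].

Definition geodesic_space : Prop := forall x y, exists c, geodesic x y c.

(* Vertices and sides are indexed by 'I_3, side i joining vertex i to vertex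
   i + 1 modulo 3. *)
Definition geodesic_triangle (v : 'I_3 -> X) (side : 'I_3 -> set X) : Prop :=
  forall i, geodesic_segment (v i) (v (ordS i)) (side i).

Definition comparison_triangle (v : 'I_3 -> X) (w : 'I_3 -> 'rV[R]_2) : Prop :=
  forall i, plane_dist (w i) (w (ordS i)) = mdist (v i) (v (ordS i)).

Definition comparison_point (v : 'I_3 -> X) (w : 'I_3 -> 'rV[R]_2)
    (i : 'I_3) x (x' : 'rV[R]_2) : Prop :=
  plane_segment (w i) (w (ordS i)) x' /\ plane_dist (w i) x' = mdist (v i) x.

Definition CAT0_inequality (v : 'I_3 -> X) (side : 'I_3 -> set X) : Prop :=
  forall w : 'I_3 -> 'rV[R]_2, comparison_triangle v w ->
  forall (i j : 'I_3) x y (x' y' : 'rV[R]_2),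
    side i x -> side j y ->
    comparison_point v w i x x' -> comparison_point v w j y y' ->
    mdist x y <= plane_dist x' y'.

Definition CAT0 : Prop :=
  geodesic_space /\
  forall v side, geodesic_triangle v side -> CAT0_inequality v side.

(* A subgroup of the group of surjective isometries of X. *)
Record isometry_group (G : set (X -> X)) : Prop := IsometryGroup {
  isometry_group_mdist :
    forall g, G g -> forall x y, mdist (g x) (g y) = mdist x y;
  isometry_group_id : G id;
  isometry_group_comp : forall g h, G g -> G h -> G (g \o h);
  isometry_group_inv :
    forall g, G g -> exists h, [/\ G h, cancel g h & cancel h g]
}.

Definition group_orbit (G : set (X -> X)) x : set X := [set g x | g in G].

Definition weighted_sup P (u : X -> R) x : R :=
  sup [set u p * mdist x p | p in P].

Definition is_barycenter P (u : X -> R) q : Prop :=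
  weighted_sup P u q = inf (range (weighted_sup P u)).

(* When X is a complete CAT(0) space, P is non-empty and bounded, and u is
   positive and bounded on P, there is exactly one barycenter and x0 is
   irrelevant; otherwise x0 is the value if there is none. *)
Definition barycenter x0 P (u : X -> R) : X := xget x0 (is_barycenter P u).

End metric_notions.

Section orbit_space.
Variables (R : realType) (X : metricType R) (G : set (X -> X)).

Definition same_orbit : rel X := fun x y => `[< group_orbit G x = group_orbit G y >].

Lemma same_orbit_refl : reflexive same_orbit.
Proof. by move=> x; apply/asboolP. Qed.

Lemma same_orbit_sym : symmetric same_orbit.
Proof. by move=> x y; apply/asboolP/asboolP. Qed.

Lemma same_orbit_trans : transitive same_orbit.
Proof. by move=> y x z /asboolP xy /asboolP yz; apply/asboolP; rewrite xy. Qed.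

Canonical same_orbit_equiv :=
  EquivRel same_orbit same_orbit_refl same_orbit_sym same_orbit_trans.

(* The quotient of X whose points are the orbits, with the quotient
   topology. *)
Definition orbit_space : Type := quotient_topology {eq_quot same_orbit}.

HB.instance Definition _ := Topological.on orbit_space.
HB.instance Definition _ := Quotient.on orbit_space.

Definition orbit_class (x : X) : orbit_space := \pi_orbit_space x.

(* The orbit is recovered from a point of the quotient as the orbit of any
   representative; it does not depend on the representative. *)
Definition barycenter_map (f : X -> R) (c : orbit_space) : orbit_space :=
  orbit_class (barycenter (repr c) (group_orbit G (repr c)) f).

End orbit_space.

(* Main.v *)
Require Import Defs.
From HB Require Import structures.
From mathcomp Require Import all_boot all_order all_algebra.
From mathcomp Require Import all_classical all_reals all_analysis.
From mathcomp Require Import ring lra.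

Set Implicit Arguments.
Unset Strict Implicit.

Import Order.TTheory GRing.Theory Num.Theory.
Import numFieldNormedType.Exports.
Local Open Scope classical_set_scope.
Local Open Scope ring_scope.

(** Write phi_x(z) for the supremum of f(p) d(z,p) over the orbit of x, and r_x
    for its infimum, so that the barycenter q_x is the minimizer of phi_x.

    The minimization of phi_x is well posed [near_minimizers_close]: all points
    whose value is close enough to r_x are close to each other.  Indeed, the
    midpoint m of two near-minimizers z1, z2 satisfies the inequality of Bruhat
    and Tits [CAT0_midpoint], and after multiplication by f(p)^2 the term
    - f(p)^2 d(z1,z2)^2 / 4 would push phi_x(m) below r_x if z1 and z2 were far
    apart.  The weight f(p) may be arbitrarily small on the orbit, which would
    weaken this term; but points p with a small weight contribute at most r_x/2
    to phi_x(m), because near-minimizers stay in a bounded region.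
    Well-posedness gives uniqueness of the barycenter and, with completeness,
    its existence as the limit of the filter of sublevel sets.

    If y is close to x, then g y is equally close to g x for every g in the
    group, so by uniform continuity of f the functions phi_x and phi_y are close
    to each other, uniformly on bounded sets [orbit_weighted_sup_le].  Both
    barycenters lie in a bounded set that does not depend on y, hence q_y is a
    near-minimizer of phi_x and q_y is close to q_x.  Thus x |-> q_x is
    continuous on X [orbit_barycenter_continuous], and by the universal property
    of the quotient topology so is the induced map of orbits. *)

(** * Comparison triangles in the Euclidean plane *)

Section PlaneGeometry.
Context {R : realType}.
Implicit Types (a b p : 'rV[R]_2).

Lemma plane_dist_ge0 a b : 0 <= plane_dist a b.
Proof. exact: sqrtr_ge0. Qed.

Lemma plane_dist_sqr a b :
  plane_dist a b ^+ 2 = (a 0 0 - b 0 0) ^+ 2 + (a 0 1 - b 0 1) ^+ 2.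
Proof.
rewrite /plane_dist sqr_sqrtr; last by apply: sumr_ge0 => k _; apply: sqr_ge0.
rewrite big_ord_recl big_ord1.
by have -> : lift ord0 ord0 = 1 :> 'I_2 by apply/val_inj.
Qed.

Lemma plane_dist_eq a b (d : R) : 0 <= d ->
  plane_dist a b ^+ 2 = d ^+ 2 -> plane_dist a b = d.
Proof. by move=> d0 /eqP; rewrite eqrXn2 ?plane_dist_ge0// => /eqP. Qed.

Lemma plane_midpoint_sqr a b p :
  plane_dist ((1 - 2^-1) *: a + 2^-1 *: b) p ^+ 2 =
  (plane_dist a p ^+ 2 + plane_dist b p ^+ 2) / 2 - plane_dist a b ^+ 2 / 4.
Proof. by rewrite !plane_dist_sqr !mxE; field. Qed.

Lemma plane_midpoint_dist a b :
  plane_dist a ((1 - 2^-1) *: a + 2^-1 *: b) = plane_dist a b / 2.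
Proof.
apply: plane_dist_eq; first by rewrite divr_ge0// plane_dist_ge0.
by rewrite exprMn !plane_dist_sqr !mxE; field.
Qed.

(** Put the first side on the horizontal axis; the abscissa s of the third
    vertex is given by the law of cosines, and Heron's product shows that
    d2^2 - s^2, the square of its ordinate, is nonnegative. *)
Lemma plane_triangle_exists (d0 d1 d2 : R) :
  0 < d0 -> 0 <= d1 -> 0 <= d2 ->
  d0 <= d1 + d2 -> d1 <= d0 + d2 -> d2 <= d0 + d1 ->
  exists a b p : 'rV[R]_2,
    [/\ plane_dist a b = d0, plane_dist b p = d1 & plane_dist p a = d2].
Proof.
move=> d0gt0 d1ge0 d2ge0 tri0 tri1 tri2.
pose s := (d0 ^+ 2 + d2 ^+ 2 - d1 ^+ 2) / (2 * d0).
have sE : 2 * d0 * s = d0 ^+ 2 + d2 ^+ 2 - d1 ^+ 2.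
  by rewrite /s; field; rewrite gt_eqF.
have sd2 : 0 <= d2 ^+ 2 - s ^+ 2.
  have heron : 0 <= (d1 - d0 + d2) * (d1 + d0 - d2) *
                    ((d0 + d2 - d1) * (d0 + d2 + d1)).
    by rewrite !mulr_ge0//; lra.
  have : 0 <= (2 * d0) ^+ 2 * (d2 ^+ 2 - s ^+ 2).
    rewrite mulrBr -[_ ^+ 2 * s ^+ 2]exprMn sE.
    by apply: le_trans heron _; rewrite le_eqVlt; apply/orP; left; apply/eqP; ring.
  by rewrite pmulr_rge0// exprn_gt0// mulr_gt0.
pose vec (x y : R) : 'rV[R]_2 := \row_k (if k == 0 then x else y).
have vecE x y x' y' :
    plane_dist (vec x y) (vec x' y') ^+ 2 = (x - x') ^+ 2 + (y - y') ^+ 2.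
  by rewrite plane_dist_sqr !mxE.
exists (vec 0 0), (vec d0 0), (vec s (Num.sqrt (d2 ^+ 2 - s ^+ 2))).
split; apply: plane_dist_eq; rewrite ?(ltW d0gt0)// vecE.
- by ring.
- by rewrite sub0r sqrrN sqr_sqrtr// sqrrB -mulr_natl mulrA sE; ring.
- by rewrite !subr0 sqr_sqrtr//; ring.
Qed.

End PlaneGeometry.

(** * Midpoints in CAT(0) spaces *)

Section Midpoints.
Context {R : realType} {X : metricType R}.
Implicit Types x y z : X.

(** In the plane this is an equality; the midpoint m of a geodesic from x to y is
    compared with the vertex z of a triangle x, y, z. *)
Lemma CAT0_midpoint (XCAT0 : CAT0 X) x y : exists m, forall z,
  mdist m z ^+ 2 <= (mdist x z ^+ 2 + mdist y z ^+ 2) / 2 - mdist x y ^+ 2 / 4.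
Proof.
have [->|xy] := eqVneq x y.
  by exists y => z; rewrite mdistxx expr0n/=; lra.
case: XCAT0 => geo CAT0X.
have xy_gt0 : 0 < mdist x y by rewrite mdist_gt0.
have [c c_geo] := geo x y.
have h0 : 0 \in `[0, mdist x y] by rewrite in_itv/= lexx ltW.
have h2 : mdist x y / 2 \in `[0, mdist x y] by rewrite in_itv/=; lra.
exists (c (mdist x y / 2)) => z.
have [[c1 c1_geo] [c2 c2_geo]] := (geo y z, geo z x).
have xm : mdist x (c (mdist x y / 2)) = mdist x y / 2.
  case: c_geo => c_0 _ /(_ _ _ h0 h2).
  by rewrite c_0 sub0r normrN ger0_norm// divr_ge0// mdist_ge0.
have [|||a [b [p [ab bp pa]]]] := @plane_triangle_exists R
    (mdist x y) (mdist y z) (mdist z x) xy_gt0 (mdist_ge0 _ _) (mdist_ge0 _ _).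
- by rewrite (metric_sym y z) (metric_sym z x) addrC metric_triangle.
- by rewrite (metric_sym z x) (metric_sym x y) metric_triangle.
- by rewrite (metric_sym z x) metric_triangle.
pose v (i : 'I_3) := nth x [:: x; y; z] i.
pose w (i : 'I_3) := nth a [:: a; b; p] i.
pose C (i : 'I_3) := nth c [:: c; c1; c2] i.
pose side (i : 'I_3) := C i @` `[0, mdist (v i) (v (ordS i))].
have triv : geodesic_triangle v side.
  by move=> i; exists (C i) => //; case: i => [[|[|[|//]]] ?].
have triw : comparison_triangle v w by move=> [[|[|[|//]]] ?].
pose i0 : 'I_3 := @Ordinal 3 0 isT; pose i2 : 'I_3 := @Ordinal 3 2 isT.
have sidem : side i0 (c (mdist x y / 2)) by exists (mdist x y / 2).
(* The vertex z is regarded as the initial point of the side from z to x. *)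
have sidez : side i2 z.
  exists 0; first by rewrite /= in_itv/= lexx mdist_ge0.
  by case: c2_geo.
have compm : comparison_point v w i0 (c (mdist x y / 2))
    ((1 - 2^-1) *: a + 2^-1 *: b).
  split; first by exists 2^-1 => //=; rewrite in_itv/=; lra.
  by rewrite plane_midpoint_dist [RHS]xm ab.
have compz : comparison_point v w i2 z p.
  split; first by exists 0;
    [rewrite /= in_itv/= lexx ler01|rewrite subr0 scale1r scale0r addr0].
  rewrite [RHS]mdistxx; apply: plane_dist_eq => //.
  by rewrite plane_dist_sqr !subrr expr0n addr0.
have := CAT0X v side triv w triw i0 i2 _ _ _ _ sidem sidez compm compz.
rewrite -(@ler_pXn2r _ 2)// ?nnegrE ?mdist_ge0 ?plane_dist_ge0// => /le_trans; apply.
rewrite plane_midpoint_sqr ab bp.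
have -> : plane_dist a p = plane_dist p a.
  by apply: plane_dist_eq; [exact: plane_dist_ge0|rewrite !plane_dist_sqr; ring].
by rewrite pa (metric_sym z x).
Qed.

End Midpoints.

(** * Weighted suprema of distances and their minimizers *)

(** The base point p0 gives a positive weight, hence a bound on the distance to
    p0 by the weighted supremum; M and D are explicit because the estimates that
    compare nearby orbits use the same M for both and diameters bounded alike. *)
Record weighted_set {R : realType} {X : metricType R} (P : set X) (u : X -> R)
    (p0 : X) (M D : R) : Prop := WeightedSet {
  weighted_base : P p0;
  weight_gt0 : forall p, P p -> 0 < u p;
  weight_le : forall p, P p -> u p <= M;
  weighted_diam : forall p q, P p -> P q -> mdist p q <= D
}.

Section WeightedSup.
Context {R : realType} {X : metricType R} (P : set X) (u : X -> R).
Context (p0 : X) (M D : R) (Pu : weighted_set P u p0 M D).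

Let Pp0 : P p0. Proof. exact: weighted_base Pu. Qed.
Let u_gt0 p : P p -> 0 < u p. Proof. exact: (weight_gt0 Pu). Qed.
Let u_le p : P p -> u p <= M. Proof. exact: (weight_le Pu). Qed.
Let diamP p q : P p -> P q -> mdist p q <= D.
Proof. exact: (weighted_diam Pu). Qed.

Local Notation phi := (weighted_sup P u).
Local Notation r := (inf (range phi)).

Lemma weighted_sup_upper z p : P p -> u p * mdist z p <= phi z.
Proof.
move=> Pp; apply: ub_le_sup; last by exists p.
exists (M * (mdist z p0 + D)) => _ [q Pq <-].
apply: ler_pM; [exact/ltW/u_gt0|exact: mdist_ge0|exact: u_le|].
by rewrite (le_trans (metric_triangle z p0 q))// lerD2l diamP.
Qed.

Lemma weighted_sup_least z (B : R) :
  (forall p, P p -> u p * mdist z p <= B) -> phi z <= B.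
Proof.
move=> uB; apply: ge_sup; first by exists (u p0 * mdist z p0), p0.
by move=> _ [p Pp <-]; exact: uB.
Qed.

Lemma weighted_sup_ge0 z : 0 <= phi z.
Proof.
apply: le_trans (weighted_sup_upper z Pp0).
by rewrite mulr_ge0 ?mdist_ge0// ltW// u_gt0.
Qed.

Lemma inf_weighted_sup_le z : r <= phi z.
Proof.
by apply: ge_inf; [exists 0 => _ [x _ <-]; exact: weighted_sup_ge0|exists z].
Qed.

Lemma inf_weighted_sup_ge0 : 0 <= r.
Proof.
apply: lb_le_inf; first by exists (phi p0), p0.
by move=> _ [x _ <-]; exact: weighted_sup_ge0.
Qed.

Lemma near_minimizer_exists (e : R) : 0 < e -> exists z, phi z <= r + e.
Proof.
move=> e0; have [|_ [z _ <-] /ltW] := @inf_adherent R (range phi) e e0.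
  split; first by exists (phi p0), p0.
  by exists 0 => _ [x _ <-]; exact: weighted_sup_ge0.
by exists z.
Qed.

Lemma weighted_sup_lipschitz z z' : phi z <= phi z' + M * mdist z z'.
Proof.
apply: weighted_sup_least => p Pp; have up0 := ltW (u_gt0 Pp).
apply: (@le_trans _ _ (u p * mdist z' p + u p * mdist z z')).
  by rewrite -mulrDr ler_wpM2l// addrC metric_triangle.
by rewrite lerD ?weighted_sup_upper// ler_wpM2r ?mdist_ge0 ?u_le.
Qed.

Lemma mdist_base_le z : mdist z p0 <= phi z / u p0.
Proof. by rewrite ler_pdivlMr ?u_gt0// mulrC weighted_sup_upper. Qed.

Hypothesis XCAT0 : CAT0 X.

(** If r = 0, the base point p0 alone forces near-minimizers close to p0.  If
    r > 0, let L bound the distances from the midpoint m of two near-minimizers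
    to the points of P, and c := r / (2 L).  The points of weight at most c
    contribute at most r / 2 to phi m.  At points of larger weight, the midpoint
    inequality makes the squared contribution at most r ^+ 2 - a as soon as the
    near-minimizers are more than eta apart.  So phi m would be smaller than r. *)
Lemma near_minimizers_close (eta : R) : 0 < eta -> exists2 delta, 0 < delta &
  forall z1 z2, phi z1 <= r + delta -> phi z2 <= r + delta -> mdist z1 z2 <= eta.
Proof.
move=> eta0; have := inf_weighted_sup_ge0; rewrite le_eqVlt => /orP[/eqP r0|r0].
  exists (u p0 * eta / 2) => [|z1 z2]; rewrite -?r0 ?add0r.
    by rewrite divr_gt0// mulr_gt0// u_gt0.
  move=> z1r z2r; rewrite (le_trans (metric_triangle z1 p0 z2))//.
  have close z : phi z <= u p0 * eta / 2 -> mdist z p0 <= eta / 2.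
    move=> zr; rewrite (le_trans (mdist_base_le z))// ler_pdivrMr ?u_gt0//.
    by rewrite (le_trans zr)// [leRHS]mulrC mulrA.
  by have := close _ z1r; have := close _ z2r; rewrite (metric_sym p0); lra.
pose K := (r + 1) / u p0; pose L := K + D.
have up0 : 0 < u p0 by exact: u_gt0.
have K0 : 0 < K by rewrite divr_gt0//; lra.
have L0 : 0 < L.
  by rewrite ltr_pwDl// -(mdistxx p0) diamP.
pose c := r / (2 * L); pose a := c ^+ 2 * eta ^+ 2 / 8.
have cL : c * L = r / 2 by rewrite /c; field; rewrite gt_eqF.
have c0 : 0 < c by rewrite divr_gt0// mulr_gt0.
have a0 : 0 < a by rewrite divr_gt0// mulr_gt0// exprn_gt0.
pose delta := Num.min 1 (a / (2 * r + 1)).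
have r1 : 0 < 2 * r + 1 by lra.
have delta0 : 0 < delta by rewrite lt_min ltr01 divr_gt0.
have delta1 : delta <= 1 by rewrite ge_min lexx.
(* As delta <= 1, this makes (r + delta) ^+ 2 exceed r ^+ 2 by at most a, which is
   half of the decrease c ^+ 2 * eta ^+ 2 / 4 at points of weight above c. *)
have deltaa : (2 * r + 1) * delta <= a.
  by rewrite mulrC -ler_pdivlMr// ge_min lexx orbT.
exists delta => // z1 z2 z1r z2r; rewrite leNgt; apply/negP => far.
have [m mCN] := CAT0_midpoint XCAT0 z1 z2.
(* Since (r - a / (2 r)) ^+ 2 >= r ^+ 2 - a, this bounds the contribution of both
   kinds of points by r - t. *)
pose t := Num.min (r / 2) (a / (2 * r)).
have t0 : 0 < t by rewrite lt_min (divr_gt0 r0)//= divr_gt0// mulr_gt0.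
have sq_le (x y : R) : 0 <= y -> x ^+ 2 <= y ^+ 2 -> x <= y.
  move=> y0 xy; have [x0|/ltW x0] := leP x 0; first exact: le_trans y0.
  by move: xy; rewrite ler_pXn2r.
suff : phi m <= r - t by have := inf_weighted_sup_le m; lra.
apply: weighted_sup_least => p Pp.
have up := ltW (u_gt0 Pp).
have [upc|upc] := leP (u p) c.
  have mp0 : mdist m p0 <= K.
    have zK z : phi z <= r + delta -> mdist z p0 ^+ 2 <= K ^+ 2.
      move=> zr; rewrite ler_pXn2r ?nnegrE ?mdist_ge0 ?(ltW K0)//.
      by rewrite (le_trans (mdist_base_le z))// ler_pM2r ?invr_gt0//; lra.
    apply: sq_le; first exact: ltW.
    have := mCN p0; have := zK _ z1r; have := zK _ z2r.
    by have := sqr_ge0 (mdist z1 z2); lra.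
  have mp : mdist m p <= L.
    by rewrite (le_trans (metric_triangle m p0 p))// lerD// diamP.
  have : u p * mdist m p <= c * L by rewrite ler_pM ?mdist_ge0.
  have : t <= r / 2 by rewrite ge_min lexx.
  by rewrite cL; lra.
set x := u p * mdist m p.
have x0 : 0 <= x by rewrite mulr_ge0// mdist_ge0.
have x2 : x ^+ 2 <= r ^+ 2 - a.
  have zr z : phi z <= r + delta -> u p ^+ 2 * mdist z p ^+ 2 <= (r + delta) ^+ 2.
    move=> zr; have uz : u p * mdist z p <= r + delta.
      exact: le_trans (weighted_sup_upper _ Pp) zr.
    have uz0 : 0 <= u p * mdist z p by rewrite mulr_ge0// mdist_ge0.
    by rewrite -exprMn ler_pXn2r// nnegrE// (le_trans uz0).
  have : 8 * a <= u p ^+ 2 * mdist z1 z2 ^+ 2.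
    rewrite /a mulrC divfK// ler_pM ?sqr_ge0//.
      by rewrite ler_pXn2r ?nnegrE ?(ltW c0)// ltW.
    by rewrite ler_pXn2r ?nnegrE ?mdist_ge0 ?(ltW eta0)// ltW.
  have : x ^+ 2 <= u p ^+ 2 *
      ((mdist z1 p ^+ 2 + mdist z2 p ^+ 2) / 2 - mdist z1 z2 ^+ 2 / 4).
    by rewrite /x exprMn ler_wpM2l ?sqr_ge0.
  have := zr _ z1r; have := zr _ z2r.
  have : (r + delta) ^+ 2 <= r ^+ 2 + a.
    have : delta * delta <= delta by rewrite ger_pMr.
    by move: deltaa; lra.
  by lra.
have tE : t <= a / (2 * r) by rewrite ge_min lexx orbT.
suff : x <= r - a / (2 * r) by lra.
have bE : 2 * r * (a / (2 * r)) = a by rewrite mulrC divfK// gt_eqF// mulr_gt0.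
have : a <= r * r by have := sqr_ge0 x; rewrite -expr2; lra.
move: bE; set b := a / (2 * r) => bE ar.
apply: sq_le.
  by rewrite subr_ge0 -(ler_pM2l r0); lra.
by rewrite sqrrB; have := sqr_ge0 b; lra.
Qed.

Lemma is_barycenter_unique q1 q2 :
  is_barycenter P u q1 -> is_barycenter P u q2 -> q1 = q2.
Proof.
move=> b1 b2; apply: mdist_positivity; apply/eqP.
rewrite eq_le mdist_ge0 andbT; apply/ler_addgt0Pl => e e0; rewrite addr0.
have [d d0] := near_minimizers_close e0.
by apply; rewrite ?b1 ?b2 lerDl ltW.
Qed.

Hypothesis Xcomplete : complete_space X.

(** The sublevel sets of phi above r generate a Cauchy filter; as phi is
    Lipschitz, its limit attains r. *)
Lemma is_barycenter_exists : exists q, is_barycenter P u q.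
Proof.
pose B e := [set z | phi z <= r + e].
pose F := filter_from [set e : R | 0 < e] B.
have FF : ProperFilter F.
  apply: filter_from_proper; last by move=> e /near_minimizer_exists.
  apply: filter_from_filter; first by exists 1 => /=.
  move=> e1 e2 /= e10 e20; exists (Num.min e1 e2).
    by rewrite /= lt_min e10 e20.
  move=> z; rewrite /B/= => zr; split.
    by rewrite (le_trans zr)// lerD2l ge_min lexx.
  by rewrite (le_trans zr)// lerD2l ge_min lexx orbT.
have [|q Fq] := Xcomplete FF.
  apply: cauchy_exP => e e0.
  have [d d0 close] := near_minimizers_close (divr_gt0 e0 (ltr0n _ 2)).
  have [z zr] := near_minimizer_exists d0.
  exists z, d => // z' z'r; rewrite ballEmdist/=.
  by apply: le_lt_trans (close _ _ zr z'r) _; lra.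
exists q; apply/eqP; rewrite eq_le inf_weighted_sup_le andbT.
have M0 : 0 < M by exact: lt_le_trans (u_gt0 Pp0) (u_le Pp0).
apply/ler_addgt0Pr => e e0.
have e20 : 0 < e / 2 by exact: divr_gt0.
have qball : F (ball q (e / 2 / M)).
  by apply: Fq; apply: nbhsx_ballx; exact: divr_gt0.
have /filter_ex[z []] : F (ball q (e / 2 / M) `&` B (e / 2)).
  by apply: filterI => //; exists (e / 2).
rewrite ballEmdist/= ltr_pdivlMr// => qz zr.
by have := weighted_sup_lipschitz q z; move: zr; rewrite /B/=; lra.
Qed.

Lemma barycenterP x0 : is_barycenter P u (barycenter x0 P u).
Proof. by apply: xgetPex; exact: is_barycenter_exists. Qed.

End WeightedSup.

(** * Dependence of the barycenter on the orbit *)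

Section OrbitBarycenter.
Context {R : realType} {X : metricType R} (G : set (X -> X)) (f : X -> R) (M : R).
Context (Gisom : isometry_group G) (fpos : forall x, 0 < f x).
Context (fM : forall x, f x <= M).
Implicit Types x y z : X.

Local Notation orbit := (group_orbit G).
Local Notation phi x := (weighted_sup (orbit x) f).

Lemma orbit_weighted_set x (D : R) :
  (forall p q, orbit x p -> orbit x q -> mdist p q <= D) ->
  weighted_set (orbit x) f x M D.
Proof.
by move=> diam; split=> //; exists id; [exact: isometry_group_id|].
Qed.

Lemma orbit_diam_le x y (d D : R) : mdist x y <= d ->
  (forall p q, orbit x p -> orbit x q -> mdist p q <= D) ->
  forall p q, orbit y p -> orbit y q -> mdist p q <= D + 2 * d.
Proof.
move=> xyd diam _ _ [g Gg <-] [h Gh <-].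
have gh : mdist (g x) (h x) <= D by apply: diam; [exists g|exists h].
have := isometry_group_mdist Gisom Gg x y.
have := isometry_group_mdist Gisom Gh x y.
have := metric_triangle (g y) (g x) (h y).
have := metric_triangle (g x) (h x) (h y).
by rewrite (metric_sym (g y) (g x)); lra.
Qed.

(** Compare the contributions of g x and g y for the same g:
    f (g x) d(z, g x) <= f (g y) d(z, g y) + f (g x) d(g x, g y)
                         + (f (g x) - f (g y)) d(z, g y). *)
Lemma orbit_weighted_sup_le x y z (d e K D D' : R) :
  weighted_set (orbit x) f x M D -> weighted_set (orbit y) f y M D' ->
  mdist x y <= d ->
  (forall g, G g -> `|f (g x) - f (g y)| <= e) ->
  (forall p, orbit y p -> mdist z p <= K) ->
  phi x z <= phi y z + (M * d + e * K).
Proof.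
move=> Wx Wy xyd fe zK; apply: (weighted_sup_least Wx) => _ [g Gg <-].
have Ogy : orbit y (g y) by exists g.
have := weighted_sup_upper Wy z Ogy.
have fd : f (g x) * mdist (g y) (g x) <= M * d.
  rewrite metric_sym (isometry_group_mdist Gisom)//.
  by apply: ler_pM; rewrite ?mdist_ge0 ?fM// ltW.
have fz : f (g x) * mdist z (g x) <= f (g x) * (mdist z (g y) + mdist (g y) (g x)).
  by apply: ler_wpM2l; [exact: ltW|exact: metric_triangle].
have : (f (g x) - f (g y)) * mdist z (g y) <= e * K.
  have e0 : 0 <= e by apply: le_trans (fe g Gg).
  apply: (@le_trans _ _ (e * mdist z (g y))); last by rewrite ler_wpM2l// zK.
  by rewrite ler_wpM2r ?mdist_ge0// (le_trans (ler_norm _))// fe.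
by move: fz; rewrite mulrDr mulrBl; lra.
Qed.

Context (XCAT0 : CAT0 X) (Xcomplete : complete_space X).
Context (Gbounded : forall x, metric_bounded (orbit x)).

Lemma orbit_barycenterP x0 x :
  is_barycenter (orbit x) f (barycenter x0 (orbit x) f).
Proof.
have [D diam] := Gbounded x.
exact: (barycenterP (orbit_weighted_set diam)).
Qed.

Lemma orbit_barycenter_indep x0 x1 x :
  barycenter x0 (orbit x) f = barycenter x1 (orbit x) f.
Proof.
have [D diam] := Gbounded x.
by apply: (is_barycenter_unique (orbit_weighted_set diam)) => //;
  exact: orbit_barycenterP.
Qed.

(** For y near x,
    phi_x(q_y) <= phi_y(q_y) + delta/2 <= phi_y(q_x) + delta/2
               <= phi_x(q_x) + delta = r_x + delta,
    so well-posedness for the orbit of x bounds the distance from q_x to q_y. *)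
Lemma orbit_barycenter_continuous : unif_continuous f ->
  continuous (fun x => barycenter x (orbit x) f).
Proof.
move=> /unif_continuousP funif x.
apply/metricType_numDomainType.cvgrPdist_lt => eps eps0 /=.
have [D diam] := Gbounded x.
have Wx := orbit_weighted_set diam.
have D0 : 0 <= D by rewrite -(mdistxx x) diam//; case: Wx.
have M0 : 0 < M by exact: lt_le_trans (fpos x) (fM x).
have [delta delta0 close] :=
  near_minimizers_close Wx XCAT0 (divr_gt0 eps0 (ltr0n _ 2)).
set q := fun y => barycenter y (orbit y) f.
have qP y : is_barycenter (orbit y) f (q y) by exact: orbit_barycenterP.
(* L bounds the distance from y to q_y for y near x, because then f y >= f x / 2
   and the orbit of y has diameter at most D + 2; K bounds the distances from q_x
   and q_y to all points of both orbits. *)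
pose L := M * (D + 2) / (f x / 2).
have L0 : 0 <= L.
  by rewrite divr_ge0// ?mulr_ge0 ?ltW// ?divr_gt0 ?fpos//; lra.
pose K := mdist (q x) x + L + D + 4.
have K0 : 0 < K by rewrite /K; have := mdist_ge0 (q x) x; lra.
pose e := Num.min (f x / 2) (delta / (4 * K)).
have e0 : 0 < e by rewrite lt_min; apply/andP; split; rewrite divr_gt0// mulr_gt0.
have eK : e * K <= delta / 4.
  by rewrite -ler_pdivlMr// -mulrA -invfM /e ge_min lexx orbT.
have [d' /= d'0 fd'] := funif e e0.
pose d := Num.min 1 (delta / (4 * M)).
have d0 : 0 < d by rewrite lt_min ltr01/= divr_gt0// mulr_gt0.
have d1 : d <= 1 by rewrite ge_min lexx.
have dM : M * d <= delta / 4.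
  by rewrite mulrC -ler_pdivlMr// -mulrA -invfM /d ge_min lexx orbT.
have near_x_lt (a : R) : 0 < a -> \forall y \near x, mdist x y < a.
  by move=> a0; apply/metricType_numDomainType.nbhs_mdistP; exists a.
near=> y.
have xyd : mdist x y <= d.
  by apply: ltW; near: y; exact: near_x_lt.
have xyd' : mdist x y < d'.
  by near: y; exact: near_x_lt.
have fxy g : G g -> `|f (g x) - f (g y)| <= e.
  move=> Gg; apply/ltW; apply: (fd' (g x, g y)).
  by rewrite /= ballEmdist/= (isometry_group_mdist Gisom).
have Wy : weighted_set (orbit y) f y M (D + 2 * d).
  by apply: orbit_weighted_set; exact: orbit_diam_le xyd diam.
have fy : f x / 2 <= f y.
  have := fxy _ (isometry_group_id Gisom); rewrite /= => /(le_trans (ler_norm _)).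
  have : e <= f x / 2 by rewrite ge_min lexx.
  lra.
have qyy : mdist (q y) y <= L.
  apply: le_trans (mdist_base_le Wy (q y)) _.
  apply: ler_pM.
  - exact: (weighted_sup_ge0 Wy).
  - by rewrite invr_ge0 ltW.
  - rewrite qP; apply: le_trans (inf_weighted_sup_le Wy y) _.
    apply: (weighted_sup_least Wy) => p Op.
    apply: ler_pM; [exact: ltW|exact: mdist_ge0|exact: fM|].
    have := weighted_diam Wy (weighted_base Wy) Op.
    lra.
  - by rewrite lef_pV2// posrE ?divr_gt0.
have near_x z : mdist z x <= mdist (q x) x + L + 1 ->
    (forall p, orbit x p -> mdist z p <= K) /\
    (forall p, orbit y p -> mdist z p <= K).
  move=> zx; split=> p Op.
    have := metric_triangle z x p.
    have := diam _ _ (weighted_base Wx) Op.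
    by rewrite /K; lra.
  have := metric_triangle z y p; have := metric_triangle z x y.
  have := weighted_diam Wy (weighted_base Wy) Op.
  by rewrite /K; lra.
have [qxx qxy] : _ /\ _ := near_x (q x) ltac:(by lra).
have [|qyx qyy'] := near_x (q y).
  have := metric_triangle (q y) y x; rewrite (metric_sym y x).
  by have := mdist_ge0 (q x) x; lra.
have step1 : phi x (q y) <= phi y (q y) + (M * d + e * K).
  exact: (orbit_weighted_sup_le Wx Wy).
have step2 : phi y (q y) <= phi y (q x).
  by rewrite qP (inf_weighted_sup_le Wy).
have step3 : phi y (q x) <= phi x (q x) + (M * d + e * K).
  apply: (orbit_weighted_sup_le Wy Wx) => //; first by rewrite metric_sym.
  by move=> g Gg; rewrite distrC fxy.
have : mdist (q x) (q y) <= eps / 2.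
  by apply: close; rewrite -?[in X in _ <= X](qP x); lra.
by lra.
Unshelve. all: by end_near. Qed.

End OrbitBarycenter.

Theorem mainTheorem11 (R : realType) (X : metricType R)
    (Xcomplete : complete_space X) (XCAT0 : CAT0 X)
    (G : set (X -> X)) (Gisom : isometry_group G)
    (Gbounded : forall x : X, metric_bounded (group_orbit G x))
    (f : X -> R) (fpos : forall x : X, 0 < f x)
    (fbounded : bounded_fun f) (funif : unif_continuous f) :
  continuous (barycenter_map (G := G) f).
Proof.
have [M fM] : exists M, forall x, f x <= M.
  have [M [_ fM]] := fbounded; exists (M + 1) => x.
  by apply: le_trans (ler_norm _) (fM (M + 1) _ x Logic.I); rewrite ltrDl.
apply/quotient_continuous.
have -> : barycenter_map f \o (\pi_(orbit_space G))%qT =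
    orbit_class G \o (fun x => barycenter x (group_orbit G x) f).
  apply/funext => x /=; rewrite /barycenter_map; congr orbit_class.
  have /eqmodP/asboolP -> :
      (repr (\pi_(orbit_space G) x) = x %[mod {eq_quot same_orbit G}])%qT.
    exact: reprK.
  (* The default points repr (\pi x) and x may differ. *)
  exact: orbit_barycenter_indep.
move=> x; apply: continuous_comp; last exact: pi_continuous.
exact: orbit_barycenter_continuous.
Qed.
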